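(* Let $\Omega\subseteq\mathbb{C}$ be open and let $f\in C^1(\Omega;\mathbb{C})$. For $z\in\Omega$ and $r>0$ with $\overline{D_r(z)}\subset\Omega$, let $c_\infty(f,r)(z)$ be any minimum point of the function $\mathcal{F}_\infty:\mathbb{C}\to[0,\infty)$ defined by $$\mathcal{F}_\infty(c)=\max_{\zeta\in\partial D_r(z)}\left|f(\zeta)-c\,\overline{(\zeta-z)}\right|,\quad c\in\mathbb{C}.$$ Then, away from the zeroes of $f$, we have that $c_\infty(f,r)=o(1)$ as $r\to0^+$ if and only if $f$ satisfies the equation $$f_{\overline z}+\frac{f}{\overline f}\,\overline f_{\overline z}=0 .$$ That is: $\lim_{r\to0^+}c_\infty(f,r)(z)=0$ for every $z\in\Omega$ with $f(z)\neq0$ if and only if the equation holds at every $z\in\Omega$ with $f(z)\ne0$.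
   Context: $D_r(z)$ is the disk in $\mathbb{C}$ centered at $z$ with radius $r$. $C^1(\Omega;\mathbb{C})$ is meant in the real sense. With $z=x+iy$: $2f_{\overline z}=f_x+i f_y$, $2f_z=f_x-i f_y$; $\overline f_{\overline z}$ denotes the $\overline z$-derivative of $\overline f$, i.e. $\overline f_{\overline z}=\overline{f_z}$. *)

(* Defs.v *)
From Stdlib Require Import Reals.
From Coquelicot Require Import Coquelicot.
Open Scope R_scope.

(* Real partial derivatives of [f : C -> C], taken componentwise.  [Derive] is
   total, hence meaningful only where [C1_on] guarantees differentiability. *)
Definition Cdx (f : C -> C) (z : C) : C :=
  (Derive (fun t => Re (f (t, Im z))) (Re z),
   Derive (fun t => Im (f (t, Im z))) (Re z)).

Definition Cdy (f : C -> C) (z : C) : C :=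
  (Derive (fun t => Re (f (Re z, t))) (Im z),
   Derive (fun t => Im (f (Re z, t))) (Im z)).

(* For [Omega] open this only depends on the values of [f] on [Omega]. *)
Definition C1_on (Omega : C -> Prop) (f : C -> C) : Prop :=
  forall z : C, Omega z ->
    ex_derive (fun t : R => Re (f (t, Im z))) (Re z) /\
    ex_derive (fun t : R => Im (f (t, Im z))) (Re z) /\
    ex_derive (fun t : R => Re (f (Re z, t))) (Im z) /\
    ex_derive (fun t : R => Im (f (Re z, t))) (Im z) /\
    continuous (Cdx f) z /\
    continuous (Cdy f) z.

Definition dbar (f : C -> C) (z : C) : C :=
  ((Cdx f z + Ci * Cdy f z) / 2)%C.

Definition closed_disk (z : C) (r : R) (w : C) : Prop := Cmod (w - z) <= r.

(* The maximum over the circle, taken as a least upper bound: for [r > 0] and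
   [f] continuous on the (compact) circle the bound is finite and attained. *)
Definition F_infty (f : C -> C) (r : R) (z c : C) : R :=
  real (Lub_Rbar (fun m : R => exists zeta : C,
    Cmod (zeta - z) = r /\ m = Cmod (f zeta - c * Cconj (zeta - z)))).

Definition is_min_point (F : C -> R) (c : C) : Prop :=
  forall c' : C, F c <= F c'.

(* Main.v *)
Require Import Defs.
From Stdlib Require Import Reals Lra.
From Coquelicot Require Import Coquelicot.
Open Scope R_scope.

(** The theorem holds pointwise, because [c_infty r z] always converges as [r]
    tends to [0+], and its limit is the left-hand side of the equation at [z].

    Fix [z] with [a = f z <> 0], write [q] and [p] for the [dbar]-derivatives of
    [f] and of its conjugate at [z], and set [L = q + (a / conj a) * p].  By
    differentiability, [f (z + h) - c * conj h] equals
    [a + conj p * h + (q - c) * conj h] up to [o(|h|)], with an error that does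
    not depend on [c].  On the circle [|h| = r] this first-order model behaves
    as follows.

    - For [c = L] the linear part is [a] times a purely imaginary number, so
      that the modulus of the model exceeds [|a|] by only [O(r^2)]
      ([linear_model_upper]).
    - For arbitrary [c], the linear part divided by [a] has real part
      [Re (conj h * (L - c) / a)].  Some [h] makes it equal to
      [r * |L - c| / |a|], and there the modulus of the model is at least
      [|a| + r * |L - c|] ([linear_model_lower]).

    Comparing the minimum value with the value at [L] gives
    [r * |L - c_infty r z| <= o(r)], uniformly in the choice of the minimum
    point and without any a priori bound on it ([min_point_cv]).  Uniqueness of
    limits then yields the equivalence. *)

(** * First-order expansion of a continuously differentiable function *)

Lemma open_disk (Omega : C -> Prop) (z : C) :
  open Omega -> Omega z ->
  exists d : posreal, forall w : C, Cmod (w - z) < d -> Omega w.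
Proof.
intros Ho Hz; destruct (Ho z Hz) as [d Hd]; exists d; intros w Hw.
apply Hd; apply C_NormedModule_mixin_compat1; exact Hw.
Qed.

Lemma real_C1_differentiable (Omega : C -> Prop) (g : C -> R) (z : C) :
  open Omega -> Omega z ->
  (forall w, Omega w -> ex_derive (fun t => g (t, Im w)) (Re w)) ->
  ex_derive (fun t => g (Re z, t)) (Im z) ->
  continuous (fun w : C => Derive (fun t => g (t, Im w)) (Re w)) z ->
  differentiable_pt_lim (fun x y => g (x, y)) (Re z) (Im z)
    (Derive (fun t => g (t, Im z)) (Re z)) (Derive (fun t => g (Re z, t)) (Im z)).
Proof.
intros Ho Hz Hx Hy Hc.
apply filterdiff_differentiable_pt_lim.
apply (is_derive_filterdiff (fun x y => g (x, y)) (Re z) (Im z)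
         (fun x y => Derive (fun t => g (t, y)) x)).
- rewrite <- surjective_pairing.
  generalize (Ho z Hz); apply filter_imp; intros w Hw.
  apply Derive_correct, (Hx w Hw).
- apply Derive_correct; exact Hy.
- rewrite <- surjective_pairing; exact Hc.
Qed.

Lemma Cmod_le_add (w : C) : Cmod w <= Rabs (Re w) + Rabs (Im w).
Proof.
replace w with (RtoC (Re w) + Ci * RtoC (Im w))%C at 1
  by (apply injective_projections; simpl; unfold Re, Im; ring).
eapply Rle_trans; [apply Cmod_triangle|].
rewrite Cmod_mult, Cmod_Ci, !Cmod_R; lra.
Qed.

Lemma dbar_conj (f : C -> C) (z : C) :
  dbar (fun w => Cconj (f w)) z = ((Cconj (Cdx f z) + Ci * Cconj (Cdy f z)) / 2)%C.
Proof.
unfold dbar; do 2 f_equal; [|f_equal]; unfold Cdx, Cdy, Cconj; simpl;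
  f_equal; apply Derive_opp.
Qed.

(** The [z]-derivative of [f] enters as the conjugate of the [dbar]-derivative
    of the conjugate of [f]. *)
Lemma C1_expansion (Omega : C -> Prop) (f : C -> C) (z : C) (eps : posreal) :
  open Omega -> C1_on Omega f -> Omega z ->
  exists d : posreal, forall h : C, Cmod h < d ->
    Cmod (f (z + h)%C - (f z + Cconj (dbar (fun w => Cconj (f w)) z) * h
                         + dbar f z * Cconj h)) <= eps * Cmod h.
Proof.
intros Ho Hf Hz.
destruct (Hf z Hz) as (Hxr & Hxi & Hyr & Hyi & Hcx & Hcy).
assert (Dr : differentiable_pt_lim (fun x y => Re (f (x, y))) (Re z) (Im z)
               (fst (Cdx f z)) (fst (Cdy f z))).
{ apply (real_C1_differentiable Omega (fun w => Re (f w))); auto.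
  - intros w Hw; apply (Hf w Hw).
  - apply (continuous_comp (Cdx f) fst); [exact Hcx|apply continuous_fst]. }
assert (Di : differentiable_pt_lim (fun x y => Im (f (x, y))) (Re z) (Im z)
               (snd (Cdx f z)) (snd (Cdy f z))).
{ apply (real_C1_differentiable Omega (fun w => Im (f w))); auto.
  - intros w Hw; apply (Hf w Hw).
  - apply (continuous_comp (Cdx f) snd); [exact Hcx|apply continuous_snd]. }
assert (He : 0 < eps / 2) by (destruct eps; simpl; lra).
destruct (Dr (mkposreal _ He)) as [d1 H1].
destruct (Di (mkposreal _ He)) as [d2 H2].
assert (Hd : 0 < Rmin d1 d2) by (apply Rmin_pos; [apply d1|apply d2]).
exists (mkposreal _ Hd); intros h Hh; simpl in Hh.
pose proof (Rmax_Cmod h) as Hm.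
pose proof (Rmax_l (Rabs (fst h)) (Rabs (snd h))) as Hl.
pose proof (Rmax_r (Rabs (fst h)) (Rabs (snd h))) as Hr.
pose proof (Rmin_l d1 d2); pose proof (Rmin_r d1 d2).
specialize (H1 (Re (z + h)%C) (Im (z + h)%C)).
specialize (H2 (Re (z + h)%C) (Im (z + h)%C)).
replace (Re (z + h)%C - Re z) with (fst h) in H1, H2 by (simpl; unfold Re; ring).
replace (Im (z + h)%C - Im z) with (snd h) in H1, H2 by (simpl; unfold Im; ring).
specialize (H1 ltac:(lra) ltac:(lra)); specialize (H2 ltac:(lra) ltac:(lra)).
simpl pos in H1, H2.
assert (Hb : eps / 2 * Rmax (Rabs (fst h)) (Rabs (snd h)) <= eps / 2 * Cmod h)
  by (apply Rmult_le_compat_l; lra).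
eapply Rle_trans; [apply Cmod_le_add|].
rewrite dbar_conj; unfold dbar.
change (f (Re (z + h)%C, Im (z + h)%C)) with (f (z + h)%C) in H1, H2.
change (f (Re z, Im z)) with (f (fst z, snd z)) in H1, H2.
rewrite <- surjective_pairing in H1, H2.
set (w := f (z + h)%C) in *; set (a := f z) in *.
set (fx := Cdx f z) in *; set (fy := Cdy f z) in *.
replace (w - (a + Cconj ((Cconj fx + Ci * Cconj fy) / 2) * h
              + (fx + Ci * fy) / 2 * Cconj h))%C
  with (w - a - (fx * RtoC (fst h) + fy * RtoC (snd h)))%C.
2: { destruct w, a, fx, fy, h; apply injective_projections; simpl; field. }
match goal with |- Rabs (Re ?X) + _ <= _ =>
  replace (Re X) with (Re w - Re a - (fst fx * fst h + fst fy * snd h))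
    by (simpl; unfold Re; ring);
  replace (Im X) with (Im w - Im a - (snd fx * fst h + snd fy * snd h))
    by (simpl; unfold Im; ring)
end.
lra.
Qed.

(** * The first-order model on a circle *)

Lemma exists_aligned (v : C) (r : R) :
  0 <= r -> exists h : C, Cmod h = r /\ (Cconj h * v)%C = RtoC (r * Cmod v).
Proof.
intros Hr; destruct (Ceq_dec v 0) as [->|Hv].
- exists (RtoC r); split.
  + rewrite Cmod_R; apply Rabs_pos_eq, Hr.
  + rewrite Cmod_0, Rmult_0_r; ring.
- assert (Hm : Cmod v <> 0) by (apply Rgt_not_eq, Cmod_gt_0, Hv).
  exists (RtoC (r / Cmod v) * v)%C; split.
  + rewrite Cmod_mult, Cmod_R, Rabs_pos_eq; [field; exact Hm|].
    apply Rdiv_le_0_compat; [exact Hr|apply Cmod_gt_0, Hv].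
  + pose proof (Cmod2_conj v) as E.
    replace (r * Cmod v) with (r / Cmod v * Cmod v ^ 2) by (field; exact Hm).
    rewrite RtoC_mult, E.
    rewrite Cmult_conj; replace (Cconj (RtoC (r / Cmod v))) with (RtoC (r / Cmod v))
      by (unfold Cconj, RtoC; simpl; f_equal; ring).
    ring.
Qed.

Lemma Cconj_neq_0 (a : C) : a <> 0 -> Cconj a <> 0.
Proof.
intros Ha; apply Cmod_gt_0; rewrite Cmod_conj; apply Cmod_gt_0, Ha.
Qed.

Lemma Cmod_1_plus_imag (s : R) : Cmod (1 + Ci * RtoC s) <= 1 + s ^ 2 / 2.
Proof.
apply Rsqr_incr_0_var; [|pose proof (pow2_ge_0 s); lra].
rewrite !Rsqr_pow2, Cmod2_alt; simpl.
pose proof (pow2_ge_0 (s ^ 2)); simpl in *; lra.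
Qed.

Lemma linear_model_upper (a p q h : C) :
  a <> 0 ->
  Cmod (a + Cconj p * h + (q - (q + a / Cconj a * p)) * Cconj h)
    <= Cmod a + 2 * (Cmod p * Cmod h) ^ 2 / Cmod a.
Proof.
intros Ha; pose proof (Cconj_neq_0 a Ha) as Ha'.
assert (Hm : 0 < Cmod a) by (apply Cmod_gt_0, Ha).
set (x := (Cconj p * h / a)%C).
(* With [x = conj p * h / a] the model is [a * (1 + x - conj x)]. *)
replace (a + Cconj p * h + (q - (q + a / Cconj a * p)) * Cconj h)%C
  with (a * (1 + Ci * RtoC (2 * Im x)))%C.
2: { assert (E : (Ci * RtoC (2 * Im x))%C = (x - Cconj x)%C).
     { rewrite im_alt', RtoC_mult; ring. }
     rewrite E; unfold x; rewrite Cdiv_conj, Cmult_conj, Cconj_conj by exact Ha.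
     field; auto. }
rewrite Cmod_mult.
assert (Hx : Cmod x = Cmod p * Cmod h / Cmod a)
  by (unfold x; rewrite Cmod_div, Cmod_mult, Cmod_conj by exact Ha; reflexivity).
assert (Hi : Im x ^ 2 <= Cmod x ^ 2)
  by (rewrite Cmod2_alt; pose proof (pow2_ge_0 (Re x)); lra).
apply Rle_trans with (Cmod a * (1 + 2 * Cmod x ^ 2)).
- apply Rmult_le_compat_l; [lra|].
  eapply Rle_trans; [apply Cmod_1_plus_imag|]; lra.
- rewrite Hx; right; field; lra.
Qed.

Lemma linear_model_lower (a p q c : C) (r : R) :
  a <> 0 -> 0 <= r ->
  exists h : C, Cmod h = r /\
    Cmod a + r * Cmod (q + a / Cconj a * p - c)
      <= Cmod (a + Cconj p * h + (q - c) * Cconj h).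
Proof.
intros Ha Hr; pose proof (Cconj_neq_0 a Ha) as Ha'.
assert (Hm : 0 < Cmod a) by (apply Cmod_gt_0, Ha).
set (v := ((q + a / Cconj a * p - c) / a)%C).
destruct (exists_aligned v r Hr) as [h [Hh Hv]].
exists h; split; [exact Hh|].
set (x := (Cconj p * h / a)%C); set (y := ((q - c) * Cconj h / a)%C).
replace (a + Cconj p * h + (q - c) * Cconj h)%C with (a * (1 + x + y))%C
  by (unfold x, y; field; exact Ha).
rewrite Cmod_mult.
(* [x] may be replaced by its conjugate, which has the same real part. *)
assert (E : (Cconj x + y)%C = RtoC (r * Cmod v)).
{ rewrite <- Hv; unfold x, y, v.
  rewrite Cdiv_conj, Cmult_conj, Cconj_conj by exact Ha; field; auto. }
assert (ER : Re (1 + x + y)%C = 1 + r * Cmod v).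
{ apply (f_equal Re) in E; simpl in E |- *; unfold Re in *; lra. }
pose proof (re_le_Cmod (1 + x + y)) as Hre; rewrite ER in Hre.
apply Rle_trans with (Cmod a * (1 + r * Cmod v)).
- unfold v; rewrite Cmod_div by exact Ha; right; field; lra.
- apply Rmult_le_compat_l; [lra|].
  eapply Rle_trans; [apply Rle_abs|exact Hre].
Qed.

(** * Bounds on the circle maximum *)

Section CircleMaximum.

Variables (f : C -> C) (r : R) (z c : C) (B : R).
Hypothesis r_ge0 : 0 <= r.
Hypothesis f_bound :
  forall h : C, Cmod h = r -> Cmod (f (z + h)%C - c * Cconj h) <= B.

Let values (m : R) : Prop := exists zeta : C,
  Cmod (zeta - z) = r /\ m = Cmod (f zeta - c * Cconj (zeta - z)).

Lemma circle_value (h : C) :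
  Cmod h = r -> values (Cmod (f (z + h)%C - c * Cconj h)).
Proof.
intros Hh; exists (z + h)%C.
replace (z + h - z)%C with h by ring; auto.
Qed.

(** The boundedness of the values makes the least upper bound a real number, so
    that [real] does not collapse it to [0]. *)
Lemma F_infty_finite : Lub_Rbar values = Finite (F_infty f r z c).
Proof.
destruct (Lub_Rbar_correct values) as [Hub Hlub].
assert (HB : Rbar_le (Lub_Rbar values) B).
{ apply Hlub; intros m [w [Hw ->]].
  replace (f w) with (f (z + (w - z))%C) by (f_equal; ring).
  apply f_bound, Hw. }
assert (Hr : Cmod (RtoC r) = r) by (rewrite Cmod_R; apply Rabs_pos_eq, r_ge0).
pose proof (Hub _ (circle_value r Hr)) as Hlow.
change (Lub_Rbar values = Finite (real (Lub_Rbar values))).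
destruct (Lub_Rbar values); simpl in *; [reflexivity|easy|easy].
Qed.

Lemma F_infty_le : F_infty f r z c <= B.
Proof.
change (Rbar_le (Finite (F_infty f r z c)) B); rewrite <- F_infty_finite.
apply Lub_Rbar_correct; intros m [w [Hw ->]].
replace (f w) with (f (z + (w - z))%C) by (f_equal; ring).
apply f_bound, Hw.
Qed.

Lemma F_infty_ge (h : C) :
  Cmod h = r -> Cmod (f (z + h)%C - c * Cconj h) <= F_infty f r z c.
Proof.
intros Hh.
change (Rbar_le (Cmod (f (z + h)%C - c * Cconj h)) (Finite (F_infty f r z c))).
rewrite <- F_infty_finite.
apply Lub_Rbar_correct, circle_value, Hh.
Qed.

End CircleMaximum.

(** * Convergence of the minimum points *)

(** The number [e] bounds the relative deviation of [f] from its linear model on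
    the circle.  No smallness of [c] is needed: in the difference between the
    function whose modulus is maximized and its model, [c] cancels. *)
Lemma min_point_estimate (f : C -> C) (a p q z c : C) (r e : R) :
  a <> 0 -> 0 < r ->
  (forall h, Cmod h = r ->
     Cmod (f (z + h)%C - (a + Cconj p * h + q * Cconj h)) <= e * r) ->
  is_min_point (F_infty f r z) c ->
  Cmod (q + a / Cconj a * p - c) <= 2 * e + 2 * Cmod p ^ 2 / Cmod a * r.
Proof.
intros Ha Hr Hf Hc.
assert (Hm : 0 < Cmod a) by (apply Cmod_gt_0, Ha).
set (L := (q + a / Cconj a * p)%C).
assert (Hclose : forall c' h, Cmod h = r ->
  Cmod (f (z + h)%C - c' * Cconj h)
    <= Cmod (a + Cconj p * h + (q - c') * Cconj h) + e * r /\
  Cmod (a + Cconj p * h + (q - c') * Cconj h)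
    <= Cmod (f (z + h)%C - c' * Cconj h) + e * r).
{ intros c' h Hh; pose proof (Hf h Hh) as Hfh.
  set (D := (f (z + h)%C - (a + Cconj p * h + q * Cconj h))%C) in *.
  set (M := (a + Cconj p * h + (q - c') * Cconj h)%C).
  split.
  - replace (f (z + h)%C - c' * Cconj h)%C with (M + D)%C by (unfold M, D; ring).
    pose proof (Cmod_triangle M D); lra.
  - replace M with (f (z + h)%C - c' * Cconj h + - D)%C at 1 by (unfold M, D; ring).
    pose proof (Cmod_triangle (f (z + h)%C - c' * Cconj h) (- D)).
    rewrite Cmod_opp in *; lra. }
assert (Hup : F_infty f r z L <= Cmod a + 2 * (Cmod p * r) ^ 2 / Cmod a + e * r).
{ apply F_infty_le; [lra|]; intros h Hh.
  pose proof (linear_model_upper a p q h Ha) as H; rewrite Hh in H; fold L in H.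
  destruct (Hclose L h Hh); lra. }
destruct (linear_model_lower a p q c r Ha (Rlt_le _ _ Hr)) as [h [Hh Hlow]].
fold L in Hlow.
assert (Hge : Cmod (f (z + h)%C - c * Cconj h) <= F_infty f r z c).
{ apply (F_infty_ge f r z c
           (Cmod a + Cmod p * r + Cmod (q - c) * r + e * r)); [lra| |exact Hh].
  intros k Hk; destruct (Hclose c k Hk) as [Hk1 _].
  pose proof (Cmod_triangle (a + Cconj p * k) ((q - c) * Cconj k)) as T1.
  pose proof (Cmod_triangle a (Cconj p * k)) as T2.
  rewrite !Cmod_mult, !Cmod_conj, Hk in *; lra. }
destruct (Hclose c h Hh) as [_ Hh2].
pose proof (Hc L) as HcL.
apply Rmult_le_reg_l with r; [exact Hr|].
replace (r * (2 * e + 2 * Cmod p ^ 2 / Cmod a * r))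
  with (2 * (e * r) + 2 * (Cmod p * r) ^ 2 / Cmod a) by (field; lra).
lra.
Qed.

Lemma min_point_cv (Omega : C -> Prop) (f : C -> C) (c : R -> C) (z : C) :
  open Omega -> C1_on Omega f -> Omega z -> f z <> RtoC 0 ->
  (forall r, 0 < r -> (forall w, closed_disk z r w -> Omega w) ->
     is_min_point (F_infty f r z) (c r)) ->
  filterlim c (at_right 0)
    (locally (dbar f z + f z / Cconj (f z) * dbar (fun w => Cconj (f w)) z)%C).
Proof.
intros Ho Hf Hz Ha Hc.
set (p := dbar (fun w => Cconj (f w)) z); set (q := dbar f z).
apply filterlim_locally; intros eps.
assert (He : 0 < eps / 4) by (destruct eps; simpl; lra).
destruct (open_disk Omega z Ho Hz) as [d1 H1].
destruct (C1_expansion Omega f z (mkposreal _ He) Ho Hf Hz) as [d2 H2].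
fold p q in H2; simpl pos in H2.
set (K := 2 * Cmod p ^ 2 / Cmod (f z)).
assert (HK : 0 <= K).
{ apply Rdiv_le_0_compat; [pose proof (pow2_ge_0 (Cmod p)); lra|].
  apply Cmod_gt_0, Ha. }
(* [K + 1] rather than [K], which vanishes when [p] does. *)
assert (Hd3 : 0 < eps / 2 / (K + 1)) by (apply Rdiv_lt_0_compat; lra).
assert (Hd : 0 < Rmin (Rmin d1 d2) (eps / 2 / (K + 1)))
  by (repeat apply Rmin_pos; [apply d1|apply d2|exact Hd3]).
exists (mkposreal _ Hd); intros r Hr Hr0.
change (Rabs (r - 0) < Rmin (Rmin d1 d2) (eps / 2 / (K + 1))) in Hr.
rewrite Rminus_0_r, Rabs_pos_eq in Hr by lra.
pose proof (Rmin_l (Rmin d1 d2) (eps / 2 / (K + 1))).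
pose proof (Rmin_r (Rmin d1 d2) (eps / 2 / (K + 1))).
pose proof (Rmin_l d1 d2); pose proof (Rmin_r d1 d2).
apply C_NormedModule_mixin_compat1.
change (Cmod (c r - (q + f z / Cconj (f z) * p)) < eps).
rewrite <- Cmod_opp.
replace (- (c r - (q + f z / Cconj (f z) * p)))%C
  with (q + f z / Cconj (f z) * p - c r)%C by ring.
assert (Hest := min_point_estimate f (f z) p q z (c r) r (eps / 4) Ha Hr0).
fold K in Hest.
assert (HKr : (K + 1) * r < eps / 2).
{ apply Rlt_le_trans with ((K + 1) * (eps / 2 / (K + 1))).
  - apply Rmult_lt_compat_l; lra.
  - right; field; lra. }
eapply Rle_lt_trans; [apply Hest|lra].
- intros h Hh; rewrite <- Hh; apply H2; lra.
- apply Hc; [exact Hr0|]; intros w Hw; apply H1.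
  unfold closed_disk in Hw; lra.
Qed.

Theorem corollary3p6
  (Omega : C -> Prop) (Omega_open : open Omega)
  (f : C -> C) (f_C1 : C1_on Omega f)
  (c_infty : R -> C -> C)
  (c_infty_min : forall (z : C) (r : R),
     Omega z -> 0 < r -> (forall w : C, closed_disk z r w -> Omega w) ->
     is_min_point (F_infty f r z) (c_infty r z)) :
  (forall z : C, Omega z -> f z <> RtoC 0 ->
     filterlim (fun r : R => c_infty r z) (at_right 0) (locally (RtoC 0)))
  <->
  (forall z : C, Omega z -> f z <> RtoC 0 ->
     (dbar f z + f z / Cconj (f z) * dbar (fun w => Cconj (f w)) z)%C = RtoC 0).
Proof.
assert (Hcv : forall z, Omega z -> f z <> RtoC 0 ->
  filterlim (fun r : R => c_infty r z) (at_right 0)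
    (locally (dbar f z + f z / Cconj (f z) * dbar (fun w => Cconj (f w)) z)%C)).
{ intros z Hz Ha; apply (min_point_cv Omega); auto. }
split; intros H z Hz Ha.
- exact (filterlim_locally_unique (V := C_NormedModule) _ _ _ (Hcv z Hz Ha) (H z Hz Ha)).
- rewrite <- (H z Hz Ha); exact (Hcv z Hz Ha).
Qed.
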